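(* For every odd integer $d\ge 5$ there exists a regular map of valency $d$ which is both self-dual and self-Petrie-dual.
   Context: A regular map is identified with a quadruple $M=(G;x,y,z)$ where $G$ is a finite group generated by three involutions $x,y,z$ such that $x$ and $y$ commute ($(xy)^2=1$); here $G\cong\mathrm{Aut}(M)$, the automorphism group of the map, which acts regularly on the flags. If $yz$ has order $k$ and $zx$ has order $\ell$, the pair $(k,\ell)$ is the type of $M$ (with $k,\ell\ge 3$); $k$ is the valency of $M$ (every vertex has valency $k$) and $\ell$ is the face length. The map $M$ is self-dual (isomorphic to its dual) if and only if $G$ has a group automorphism interchanging $x$ and $y$ and fixing $z$; it is self-Petrie-dual (isomorphic to its Petrie dual) if and only if $G$ has a group automorphism interchanging $x$ and $xy$ and fixing $y$ and $z$. *)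

(* Defs.v *)
From HB Require Import structures.
From mathcomp Require Import all_boot all_fingroup.

Set Implicit Arguments.
Unset Strict Implicit.
Unset Printing Implicit Defensive.

Local Open Scope group_scope.

(* x, y and z are the flag reflections: the vertex, edge and face stabilisers *)
(* are <y, z>, <x, y> and <z, x>, so the type (k, l) consists of the orders   *)
(* of y * z and z * x.                                                        *)
Record regular_map := RegularMap {
  rm_gT : finGroupType;
  rm_group : {group rm_gT};
  rm_x : rm_gT;
  rm_y : rm_gT;
  rm_z : rm_gT;
  rm_gen : <<[set rm_x; rm_y; rm_z]>> = rm_group;
  rm_x_invol : #[rm_x] = 2;
  rm_y_invol : #[rm_y] = 2;
  rm_z_invol : #[rm_z] = 2;
  rm_xy_sq : (rm_x * rm_y) ^+ 2 = 1;
  rm_valency_ge3 : 3 <= #[rm_y * rm_z];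
  rm_face_length_ge3 : 3 <= #[rm_z * rm_x]
}.

Definition valency (M : regular_map) : nat := #[rm_y M * rm_z M].

Definition face_length (M : regular_map) : nat := #[rm_z M * rm_x M].

Definition self_dual (M : regular_map) : Prop :=
  exists2 f : {perm rm_gT M}, f \in Aut (rm_group M) &
    [/\ f (rm_x M) = rm_y M, f (rm_y M) = rm_x M & f (rm_z M) = rm_z M].

(* Such an f sends x to x * y, so x * y is an involution and x != y: the      *)
(* degenerate quadruples with x = y are never self-Petrie-dual.               *)
Definition self_petrie_dual (M : regular_map) : Prop :=
  exists2 f : {perm rm_gT M}, f \in Aut (rm_group M) &
    [/\ f (rm_x M) = rm_x M * rm_y M, f (rm_x M * rm_y M) = rm_x M,
        f (rm_y M) = rm_y M & f (rm_z M) = rm_z M].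

(* Main.v *)
(** In SO(3), let x, y and xy be the half-turns about the coordinate axes and z
    the half-turn about (1,1,1). Permuting the coordinates fixes z and permutes
    x, y, xy in all possible ways, which gives both dualities. The rotation yz
    has eigenvalue a/a' with a = 1 + sqrt(-2), so for d = 2k + 1 it has order
    dividing d modulo N = (a^d - a'^d)/(a - a'). A 2-adic computation shows that
    N is different from 1 and -1 as soon as d >= 5.

    The order of yz in the resulting finite group K may be a proper divisor of
    d. It is corrected by the covering K x Z/m, m = d/#[yz], in which the
    second coordinate counts passages through the single edge {1, z} of the
    Cayley graph of K: conjugation by the coordinate permutations preserves
    this edge, and a cycle of yz, having odd length, traverses it at most
    once. *)
From mathcomp Require Import all_boot all_fingroup all_solvable all_algebra.
From mathcomp Require Import zify ring.
Require Import Defs.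

Set Implicit Arguments.
Unset Strict Implicit.
Unset Printing Implicit Defensive.

Import GRing.Theory.

(** * Cyclic coverings, realised as permutations of [K * 'I_m.+1] *)

Section Cover.
Local Open Scope group_scope.

Lemma order_involution (gT : finGroupType) (a : gT) :
  a * a = 1 -> a != 1 -> #[a] = 2.
Proof. by move=> aa a1; apply: nt_prime_order; rewrite // expgS expg1. Qed.

Variables (K : finGroupType) (y z : K) (m : nat).
Hypotheses (yy : y * y = 1) (zz : z * z = 1) (z_neq1 : z != 1).

Local Notation Om := (K * 'I_m.+1)%type.

Definition trans_fun (g : K) (p : Om) : Om := (p.1 * g, p.2).

Lemma trans_fun_inj g : injective (trans_fun g).
Proof. by move=> [k i] [l j] [] /mulIg -> ->. Qed.

Definition trans g : {perm Om} := perm (@trans_fun_inj g).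

(* For m = 0 the group 'I_1 is trivial and inord 1 is its zero. *)
Definition weight (k : K) : 'I_m.+1 :=
  if k == 1 then inord 1 else if k == z then (- inord 1)%R else 0%R.

(** The two directions of the edge {1, z} carry opposite weights; this is what makes [twist] an
    involution. *)
Lemma weightMz k : (weight k + weight (k * z) = 0)%R.
Proof.
have kz1 : (k * z == 1) = (k == z) by rewrite -zz (inj_eq (mulIg z)).
have kzz : (k * z == z) = (k == 1) by rewrite -{2}[z]mul1g (inj_eq (mulIg z)).
rewrite /weight kz1 kzz; case: (eqVneq k 1) => [->|_].
  by rewrite eq_sym (negbTE z_neq1) addrN.
by case: eqP; rewrite ?addNr ?addr0.
Qed.

Definition twist_fun (p : Om) : Om := (p.1 * z, (p.2 + weight p.1)%R).

Lemma twist_funK : involutive twist_fun.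
Proof.
move=> [k i]; rewrite /twist_fun /= -mulgA zz mulg1 -addrA.
by rewrite weightMz addr0.
Qed.

Definition twist : {perm Om} := perm (inv_inj twist_funK).

Definition inner_fun (g : K) (p : Om) : Om := (p.1 ^ g, p.2).

Lemma inner_fun_inj g : injective (inner_fun g).
Proof. by move=> [k i] [l j] [] /conjg_inj -> ->. Qed.

Definition inner g : {perm Om} := perm (@inner_fun_inj g).

Lemma transM g h : trans g * trans h = trans (g * h).
Proof. by apply/permP=> -[k i]; rewrite permM !permE /trans_fun /= mulgA. Qed.

Lemma trans1 : trans 1 = 1.
Proof. by apply/permP=> -[k i]; rewrite !permE /trans_fun mulg1. Qed.

Lemma trans_neq1 g : g != 1 -> trans g != 1.
Proof.
apply: contraNneq => /permP/(_ (1, 0%R)).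
by rewrite !permE /trans_fun mul1g => -[->].
Qed.

Lemma twist_neq1 : twist != 1.
Proof.
apply: contraNneq z_neq1 => /permP/(_ (1, 0%R)).
by rewrite !permE /twist_fun mul1g => -[->].
Qed.

Lemma trans_inner g h : trans g ^ inner h = trans (g ^ h).
Proof.
apply: (mulgI (inner h)); rewrite -conjgC.
by apply/permP=> -[k i]; rewrite !permM !permE /inner_fun /trans_fun /= conjMg.
Qed.

(** Conjugation by [g] fixes both ends 1 and [z] of the weighted edge, so it preserves [weight]. *)
Lemma twist_inner g : z ^ g = z -> twist ^ inner g = twist.
Proof.
move=> zg; apply: (mulgI (inner g)); rewrite -conjgC.
apply/permP=> -[k i]; rewrite !permM !permE /inner_fun /twist_fun /=.
rewrite conjMg zg /weight -(inj_eq (conjg_inj g) k 1) conj1g.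
by rewrite -(inj_eq (conjg_inj g) k z) zg.
Qed.

Lemma trans_twistX n k i :
  ((trans y * twist) ^+ n) (k, i) =
  (k * (y * z) ^+ n, (i + \sum_(j < n) weight (k * (y * z) ^+ j * y))%R).
Proof.
elim: n => [|n IHn]; first by rewrite perm1 big_ord0 addr0 mulg1.
rewrite expgSr permM IHn permM !permE /trans_fun /twist_fun /=.
by rewrite big_ord_recr /= addrA expgSr !mulgA.
Qed.

Lemma trans_twist_period q k i :
  ((trans y * twist) ^+ (#[y * z] * q)) (k, i) =
  (k, (i + (\sum_(j < #[y * z]) weight (k * (y * z) ^+ j * y)) *+ q)%R).
Proof.
elim: q => [|q IHq]; first by rewrite muln0 perm1 addr0.
rewrite mulnS addnC expgD permM IHq trans_twistX expg_order mulg1.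
by rewrite mulrSr addrA.
Qed.

(* The value z does not occur, since <[y * z]> has odd order and so contains no
   conjugate of the involution z. *)
Lemma weight_sum_y : odd #[y * z] ->
  (\sum_(j < #[y * z]) weight (y * (y * z) ^+ j * y))%R = inord 1.
Proof.
move=> odd_yz; have [n on] : exists n, #[y * z] = n.+1.
  by exists #[y * z].-1; rewrite prednK ?order_gt0.
(* The term j = 0 is the weight of [y * y = 1]. A later argument equal to 1 would force
   [(y * z) ^+ j = 1] with 0 < j < [#[y * z]]. *)
rewrite on big_ord_recl big1 => [|j _].
  by rewrite expg0 mulg1 yy /weight eqxx addr0.
rewrite /weight; case: eqP => [eq1|_].
  have /eqP : (y * z) ^+ (lift ord0 j) = 1.
    apply: (mulgI y); apply: (mulIg y); rewrite eq1 mulg1 yy //.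
  rewrite -order_dvdn on /= /bump /= => /dvdn_leq; rewrite addSn add0n => /(_ isT).
  by rewrite ltnS leqNgt ltn_ord.
case: eqP => [eqz|//]; case/negP: z_neq1; apply/eqP.
have yzj : (y * z) ^+ lift ord0 j = z ^ y.
  rewrite -[in RHS]eqz conjgE !mulgA.
  have -> : y^-1 = y by apply: (mulgI y); rewrite mulgV yy.
  by rewrite yy mul1g -!mulgA yy mulg1.
have : (z ^ y) ^+ #[y * z] = 1 by rewrite -yzj expgAC expg_order expg1n.
rewrite -conjXg -{1}(conj1g y) => /conjg_inj.
rewrite -(odd_double_half #[y * z]) odd_yz expgD -mul2n expgM.
by rewrite (_ : z ^+ 2 = 1) ?expg1n ?mulg1 // expgS expg1.
Qed.

(** After [#[y * z]] steps only the second coordinate has moved, so [m.+1] rounds suffice. On the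
    orbit of [(y, 0)] each round adds the generator [inord 1], so no fewer rounds do. *)
Lemma order_trans_twist : odd #[y * z] ->
  #[trans y * twist] = (#[y * z] * m.+1)%N.
Proof.
move=> odd_yz; apply/eqP; rewrite eqn_dvd order_dvdn; apply/andP; split.
  apply/eqP/permP=> -[k i]; rewrite trans_twist_period perm1.
  by rewrite Zp_mulrn /=; congr (_, _); apply/val_inj; rewrite /= modnMl addn0 modn_small.
have /dvdnP [q oq] : (#[y * z] %| #[trans y * twist])%N.
  rewrite order_dvdn; apply/eqP.
  have := trans_twistX #[trans y * twist] 1 0%R.
  by rewrite expg_order perm1 mul1g => -[<-].
rewrite oq mulnC dvdn_pmul2r ?order_gt0 //.
have := trans_twist_period q y 0%R.
rewrite mulnC -oq expg_order perm1 weight_sum_y // add0r => -[].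
move/(congr1 val); rewrite /= Zp_mulrn /= => /esym.
case: m => [|m'] //; rewrite inordK // mul1n => /eqP; exact.
Qed.

End Cover.

(** * From a group with two dualities to a regular map of prescribed valency *)

Section Assembly.
Local Open Scope group_scope.

Lemma conj_aut_gen (gT : finGroupType) (A : {set gT}) (a : gT) :
  {in A, forall u, u ^ a \in <<A>>} ->
  exists2 f : {perm gT}, f \in Aut <<A>> & {in <<A>>, forall u, f u = u ^ a}.
Proof.
move=> Aa; have nA : a \in 'N(<<A>>).
  rewrite inE -genJ gen_subG; apply/subsetP=> _ /imsetP[u uA ->]; exact: Aa.
exists (conj_aut <<A>>%G a); first exact: Aut_aut.
by move=> u uA; rewrite norm_conj_autE.
Qed.

(** The covering with [m.+1] equal to d / [#[y * z]] corrects the order, and [s], [t] lift to it as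
    [inner m s], [inner m t]. These normalise the group of the map without having to lie in it. *)
Lemma regular_map_of_odd_order (K : finGroupType) (x y z s t : K) (d : nat) :
  odd d -> (2 < d)%N -> #[y * z] %| d ->
  x * x = 1 -> y * y = 1 -> z * z = 1 ->
  x != 1 -> y != 1 -> z != 1 ->
  x ^ s = y -> y ^ s = x -> z ^ s = z ->
  x ^ t = x * y -> y ^ t = y -> z ^ t = z ->
  exists M : regular_map,
    [/\ valency M = d, self_dual M & self_petrie_dual M].
Proof.
move=> odd_d d_gt2 dvd_d xx yy zz x1 y1 z1 xs ys zs xt yt zt.
have [m dE] : exists m, d = (#[y * z] * m.+1)%N.
  case/dvdnP: dvd_d => q; rewrite mulnC; case: q => [|m ->]; last by exists m.
  by rewrite muln0 => d0; rewrite d0 in d_gt2.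
have odd_yz : odd #[y * z] by move: odd_d; rewrite dE oddM => /andP[].
pose X := trans m x; pose Y := trans m y; pose Z := twist m zz z1.
have oYZ : #[Y * Z] = d by rewrite /Y order_trans_twist.
have Zs : Z ^ inner m s = Z by apply: twist_inner.
have Zt : Z ^ inner m t = Z by apply: twist_inner.
have Xs : X ^ inner m s = Y by rewrite trans_inner xs.
have Ys : Y ^ inner m s = X by rewrite trans_inner ys.
have Xt : X ^ inner m t = X * Y by rewrite trans_inner xt transM.
have Yt : Y ^ inner m t = Y by rewrite trans_inner yt.
have XX : X * X = 1 by rewrite transM xx trans1.
have YY : Y * Y = 1 by rewrite transM yy trans1.
have ZZ : Z * Z = 1 by apply/permP=> p; rewrite permM !permE twist_funK.
have XYt : (X * Y) ^ inner m t = X by rewrite conjMg Xt Yt -mulgA YY mulg1.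
(* [X * Y] is a conjugate of the involution [X]. *)
have XY2 : (X * Y) ^+ 2 = 1 by rewrite -Xt -conjXg expgS expg1 XX conj1g.
pose A := [set X; Y; Z].
have [XA YA ZA] : [/\ X \in <<A>>, Y \in <<A>> & Z \in <<A>>].
  by split; apply: mem_gen; rewrite !inE eqxx ?orbT.
(* The inverse of [Z * X] is [X * Z], which [inner m s] conjugates to [Y * Z]. *)
have oZX : #[Z * X] = d.
  have invol (g : {perm K * 'I_m.+1}) : g * g = 1 -> g^-1 = g.
    by move=> gg; apply: (mulgI g); rewrite mulgV gg.
  rewrite -orderV invMg !invol // -oYZ -(orderJ _ (inner m s)) conjMg.
  by rewrite Xs Zs.
have X_invol : #[X] = 2 by apply: order_involution => //; apply: trans_neq1.
have Y_invol : #[Y] = 2 by apply: order_involution => //; apply: trans_neq1.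
have Z_invol : #[Z] = 2 by apply: order_involution => //; apply: twist_neq1.
have YZ_ge3 : 3 <= #[Y * Z] by rewrite oYZ.
have ZX_ge3 : 3 <= #[Z * X] by rewrite oZX.
exists (@RegularMap _ <<A>>%G X Y Z (erefl _) X_invol Y_invol Z_invol XY2
          YZ_ge3 ZX_ge3); split=> //.
  have [u|f fA fE] := @conj_aut_gen _ A (inner m s).
    by rewrite !inE -orbA => /or3P[] /eqP->; rewrite ?Xs ?Ys ?Zs.
  by exists f => //=; rewrite !fE.
have [u|f fA fE] := @conj_aut_gen _ A (inner m t).
  by rewrite !inE -orbA => /or3P[] /eqP->; rewrite ?Xt ?Yt ?Zt ?groupM.
by exists f => //=; rewrite !fE ?groupM.
Qed.

End Assembly.

(** * Arithmetic of the odd powers of 1 + sqrt(-2) *)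

Section Rotations.
Local Open Scope ring_scope.

(* The pair (a, b) encodes a + b * sqrt(-2), and omega is
   (1 + sqrt(-2))^2 = -1 + 2 * sqrt(-2). *)
Fixpoint omega_pow (k : nat) : int * int :=
  if k is k'.+1 then
    let p := omega_pow k' in (- p.1 - 4 * p.2, 2 * p.1 - p.2)
  else (1, 0).

(* The coefficient of sqrt(-2) in (1 + sqrt(-2))^(2k + 1). *)
Definition lucas (k : nat) : int := (omega_pow k).1 + (omega_pow k).2.

Lemma omega_powD m n :
  omega_pow (m + n) =
  ((omega_pow m).1 * (omega_pow n).1 - 2 * ((omega_pow m).2 * (omega_pow n).2),
   (omega_pow m).1 * (omega_pow n).2 + (omega_pow m).2 * (omega_pow n).1).
Proof.
elim: m => [|m IHm] /=; first by case: (omega_pow n) => a b /=; congr pair; ring.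
by rewrite IHm /=; congr pair; ring.
Qed.

(** The square of 1 + sqrt(-2) has trace -2 and norm 9. *)
Lemma lucasSS k : lucas k.+2 = - 2 * lucas k.+1 - 9 * lucas k.
Proof. by rewrite /lucas /=; ring. Qed.

(** The recurrence preserves the residue 1, since -2 - 9 = -11 is 1 modulo 12. *)
Lemma lucas_mod12 k : exists c : int, lucas k = 1 + 12 * c.
Proof.
suff [] : (exists c : int, lucas k = 1 + 12 * c) /\
          (exists c : int, lucas k.+1 = 1 + 12 * c) by [].
elim: k => [|k [[c ec] [c' ec']]]; first by split; exists 0.
split; first by exists c'.
by exists (- 1 - 2 * c' - 9 * c); rewrite lucasSS ec ec'; ring.
Qed.

(** Induction on [j] by squaring, which raises the 2-adic valuation of the coefficient of sqrt(-2)
    by exactly one. *)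
Lemma omega_pow_2adic j r : exists A B : int,
  omega_pow (2 ^ j.+1 * r.*2.+1) =
    (1 + 2 ^+ j.+3 * A, 2 ^+ j.+2 * (1 + 2 * B)).
Proof.
elim: j => [|j [A [B IHj]]].
  (* Raising [r] by one multiplies by the fourth power of omega, 17 + 56 sqrt(-2); hence the
     constants in the witnesses. *)
  elim: r => [|r [A [B IHr]]]; first by exists (- 1), (- 1).
  rewrite (_ : (2 ^ 1 * r.+1.*2.+1 = 4 + 2 ^ 1 * r.*2.+1)%N); last by lia.
  rewrite omega_powD IHr /=.
  exists (2 + 17 * A - 2 * 7 * 4 * (1 + 2 * B)), (7 + 8 * 7 * A + 17 * B + 8).
  by congr pair; ring.
rewrite (_ : (2 ^ j.+2 * r.*2.+1 = 2 ^ j.+1 * r.*2.+1 + 2 ^ j.+1 * r.*2.+1)%N);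
  last by rewrite expnS -mulnA mul2n addnn.
rewrite omega_powD IHj /=.
exists (A + 2 ^+ j.+2 * A ^+ 2 - 2 ^+ j.+1 * (1 + 2 * B) ^+ 2),
       (B + 2 ^+ j.+2 * A * (1 + 2 * B)).
by rewrite !exprS; congr pair; ring.
Qed.

Lemma lucas_2adic_even j r :
  exists B : int, lucas (2 ^ j.+1 * r.*2.+1) = 1 + 2 ^+ j.+2 * (1 + 2 * B).
Proof.
have [A [B e]] := omega_pow_2adic j r; exists (A + B); rewrite /lucas e /=.
by rewrite !exprS; ring.
Qed.

(** One more factor omega turns the sum [p.1 + p.2] into [p.1 - 5 * p.2]; as 5 is odd, the valuation
    is unchanged. *)
Lemma lucas_2adic_odd j r :
  exists B : int, lucas (2 ^ j.+1 * r.*2.+1).+1 = 1 + 2 ^+ j.+2 * (1 + 2 * B).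
Proof.
have [A [B e]] := omega_pow_2adic j r.
exists (A - 5 * B - 3); rewrite /lucas /= e /=.
by rewrite !exprS; ring.
Qed.

Lemma even_decomp n : (0 < n)%N -> ~~ odd n ->
  exists j r, n = (2 ^ j.+1 * r.*2.+1)%N.
Proof.
elim/ltn_ind: n => n IHn n_gt0 n_even.
have en : n = n./2.*2 by rewrite even_halfK.
have [odd_h|even_h] := boolP (odd n./2).
  exists 0%N, n./2./2; rewrite {1}en -{1}(odd_double_half n./2) odd_h.
  by rewrite add1n expn1 mul2n.
have [|||j [r e]] := IHn n./2; [lia | lia | exact: even_h | ].
by exists j.+1, r; rewrite {1}en e -mul2n mulnA -expnS.
Qed.

(** One of [k] and [k.-1] is even, and both are positive, so [lucas k - 1] is a power of two times
    an odd integer. *)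
Lemma lucas_neq1 k : (1 < k)%N -> lucas k != 1.
Proof.
move=> k_gt1.
have [B [j ->]] : exists B : int, exists j, lucas k = 1 + 2 ^+ j * (1 + 2 * B).
  have [k_odd|k_even] := boolP (odd k).
    have [||j [r e]] := @even_decomp k.-1; [lia | lia | ].
    have [B eB] := lucas_2adic_odd j r; exists B, j.+2.
    by rewrite -eB -e prednK //; lia.
  have [||j [r ->]] := @even_decomp k; [lia | by [] | ].
  by have [B eB] := lucas_2adic_even j r; exists B, j.+2.
rewrite -subr_eq0 addrC addKr mulf_neq0 ?expf_neq0 //.
by apply/eqP; lia.
Qed.

(** The integers closest to 0 that are 1 modulo 12, apart from 1 itself, are -11 and 13. *)
Lemma lucas_abs_gt k : (1 < k)%N -> (10 < `|lucas k|)%N.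
Proof.
move=> /lucas_neq1 /eqP; have [c ->] := lucas_mod12 k; lia.
Qed.

Lemma lucas_coprime3 k : coprime `|lucas k| 3.
Proof.
have [c ->] := lucas_mod12 k.
rewrite coprime_sym prime_coprime //; lia.
Qed.

(** * Periodicity of the linear recurrence satisfied by the rotation *)

Section Recurrence.
Variables (R : comPzRingType) (a : nat -> R).
Hypothesis a_rec : forall n,
  3 * a n.+3 + 2 * a n.+2 + 3 * a n.+1 = 3 * a n.+2 + 2 * a n.+1 + 3 * a n.

Lemma recurrence_const m n :
  3 * a (m + n).+2 + 2 * a (m + n).+1 + 3 * a (m + n)
  = 3 * a n.+2 + 2 * a n.+1 + 3 * a n.
Proof. by elim: m => [//|m <-]; rewrite addSn a_rec. Qed.

(** The characteristic roots are 1, for which both sides vanish, and t = p/q and its inverse, where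
    p, q = 1 ± sqrt(-2) and pq = 3. For these, (t^(2k+1) - 1) / (t^k (t - 1)) = (p^(2k+1) -
    q^(2k+1)) / ((p - q) 3^k), which is [lucas k] over 3^k. *)
Lemma recurrence_window k n :
  3 ^+ k * (a (n + k.*2.+1) - a n) =
  (lucas k)%:~R * (a (n + k.+1) - a (n + k)).
Proof.
suff [] : (forall n, 3 ^+ k * (a (n + k.*2.+1) - a n) =
      (lucas k)%:~R * (a (n + k.+1) - a (n + k))) /\
    (forall n, 3 ^+ k.+1 * (a (n + k.+1.*2.+1) - a n) =
      (lucas k.+1)%:~R * (a (n + k.+2) - a (n + k.+1))) by [].
elim: k {n} => [|k [IH0 IH1]].
  split=> n; first by rewrite addn0 !mul1r.
  rewrite !addnS addn0 expr1 mul1r; have := a_rec n => e.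
  have -> : 3 * (a n.+3 - a n) = 3 * a n.+3 + 2 * a n.+2 + 3 * a n.+1
     - (2 * a n.+2 + 3 * a n.+1 + 3 * a n) by ring.
  by rewrite e; ring.
split=> // n; rewrite lucasSS.
(* The shifts make the three windows concentric, so their right-hand sides share the same central
   difference. *)
have e0 := IH0 n.+2; have e1 := IH1 n.+1; have e := recurrence_const (k.*2.+3) n.
have E2 : (n + k.+2.*2.+1 = (n + k.*2).+4.+1)%N by lia.
have E1 : (n.+1 + k.+1.*2.+1 = (n + k.*2).+4)%N by lia.
have E0 : (n.+2 + k.*2.+1 = (n + k.*2).+3)%N by lia.
have E : (k.*2.+3 + n = (n + k.*2).+3)%N by lia.
rewrite E0 !addSnnS in e0; rewrite E1 !addSnnS in e1.
rewrite E in e; rewrite E2 2!exprS rmorphB !rmorphM mulrBl -!mulrA -e0 -e1.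
have {}e : 3 * a (n + k.*2).+4.+1 = 3 * a n.+2 + 2 * a n.+1 + 3 * a n
   - 2 * a (n + k.*2).+4 - 3 * a (n + k.*2).+3 by rewrite -e; ring.
rewrite [3 ^+ k.+1]exprS.
transitivity (3 * 3 ^+ k * (3 * a (n + k.*2).+4.+1 - 3 * a n)); first by ring.
by rewrite e; ring.
Qed.

End Recurrence.

Lemma recurrence_periodic (R : comUnitRingType) (a : nat -> R) k :
  (forall n, 3 * a n.+3 + 2 * a n.+2 + 3 * a n.+1 =
             3 * a n.+2 + 2 * a n.+1 + 3 * a n) ->
  (3 : R) \is a GRing.unit -> (lucas k)%:~R = 0 :> R -> a k.*2.+1 = a 0%N.
Proof.
move=> a_rec u3 lk0; have := recurrence_window a_rec k 0.
rewrite lk0 mul0r add0n => /(canRL (mulKr (unitrX k u3))).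
by rewrite mulr0 => /eqP; rewrite subr_eq0 => /eqP.
Qed.

(** * Half-turns of the cube of a finite ring in which 3 is invertible *)

Section HalfTurns.
Variables (R : finComUnitRingType) (e : R).
Hypothesis (e3 : 3 * e = 1).
Local Notation V := (R * R * R)%type.

Definition half_turn1 (v : V) : V := let: (a, b, c) := v in (a, - b, - c).
Definition half_turn2 (v : V) : V := let: (a, b, c) := v in (- a, b, - c).
(** This is twice the orthogonal projection onto the line of (1, 1, 1), minus the identity; [e]
    stands for 1/3. *)
Definition half_turn_diag (v : V) : V :=
  let: (a, b, c) := v in
  let r := 2 * e * (a + b + c) in (r - a, r - b, r - c).
Definition swap12 (v : V) : V := let: (a, b, c) := v in (b, a, c).
Definition swap13 (v : V) : V := let: (a, b, c) := v in (c, b, a).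

Lemma half_turn1K : involutive half_turn1.
Proof. by move=> [[a b] c]; rewrite /= !opprK. Qed.

Lemma half_turn2K : involutive half_turn2.
Proof. by move=> [[a b] c]; rewrite /= !opprK. Qed.

Lemma third_double s : 3 * (2 * e * s) = 2 * s.
Proof. by rewrite !mulrA [3 * 2]mulrC -(mulrA 2) e3 mulr1. Qed.

Lemma half_turn_diagK : involutive half_turn_diag.
Proof.
move=> [[a b] c]; rewrite /half_turn_diag; set r := 2 * e * (a + b + c).
have -> : 2 * e * (r - a + (r - b) + (r - c)) = r.
  transitivity (2 * (3 * e) * r - r); first by rewrite /r; ring.
  by rewrite e3; ring.
by congr (_, _, _); ring.
Qed.

Lemma swap12K : involutive swap12. Proof. by move=> [[a b] c]. Qed.
Lemma swap13K : involutive swap13. Proof. by move=> [[a b] c]. Qed.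

Definition rot (v : V) : V := half_turn_diag (half_turn2 v).

(* The rotation satisfies (rot - 1)(3 rot^2 + 2 rot + 3) = 0. *)
Lemma rot_rec (pr : V -> R) (v : V) :
  [\/ pr = (fun v => v.1.1), pr = (fun v => v.1.2) | pr = (fun v => v.2)] ->
  3 * pr (rot (rot (rot v))) + 2 * pr (rot (rot v)) + 3 * pr (rot v) =
  3 * pr (rot (rot v)) + 2 * pr (rot v) + 3 * pr v.
Proof.
case: v => [[a b] c]; rewrite /rot /half_turn_diag /half_turn2.
(* Each [r] becomes a free variable tied only by a relation 3r = 2s; the goal is then a linear
   combination of these relations. *)
set r0 := 2 * e * (- a + _ + _); have := third_double (- a + b - c).
rewrite -/r0; move: r0 => r0 h0.
set r1 := 2 * e * (- (r0 - _) + _ + _).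
have := third_double (- (r0 - - a) + (r0 - b) - (r0 - - c)).
rewrite -/r1; move: r1 => r1 h1.
set s2 := - (r1 - _) + _ + _; have := third_double s2.
set r2 := 2 * e * s2; move: r2 => r2 h2.
have {}h0 : 3 * r0 - 2 * (- a + b - c) = 0 by rewrite h0 subrr.
have {}h1 : 3 * r1 - 2 * (- (r0 - - a) + (r0 - b) - (r0 - - c)) = 0.
  by rewrite h1 subrr.
have {}h2 : 3 * r2 - 2 * s2 = 0 by rewrite h2 subrr.
case=> -> /=; apply/eqP; rewrite -subr_eq0; apply/eqP.
- rewrite -[RHS](_ : 3 * r2 - 2 * s2 - (3 * r0 - 2 * (- a + b - c)) = 0).
    by rewrite /s2; ring.
  by rewrite h2 h0 subrr.
- rewrite -[RHS](_ : 3 * r2 - 2 * s2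
     - 2 * (3 * r1 - 2 * (- (r0 - - a) + (r0 - b) - (r0 - - c)))
     + (3 * r0 - 2 * (- a + b - c)) = 0).
    by rewrite /s2; ring.
  by rewrite h2 h1 h0 mulr0 subrr addr0.
- rewrite -[RHS](_ : 3 * r2 - 2 * s2 - (3 * r0 - 2 * (- a + b - c)) = 0).
    by rewrite /s2; ring.
  by rewrite h2 h0 subrr.
Qed.

(** By [rot_rec], each coordinate along the orbit of [v] satisfies the recurrence, whose period is
    then read off from [recurrence_periodic]. *)
Lemma iter_rot k v : (lucas k)%:~R = 0 :> R -> iter k.*2.+1 rot v = v.
Proof.
move=> lk0.
have u3 : (3 : R) \is a GRing.unit by apply/unitrPr; exists e.
have per (pr : V -> R) : 
    [\/ pr = (fun v => v.1.1), pr = (fun v => v.1.2) | pr = (fun v => v.2)] ->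
    pr (iter k.*2.+1 rot v) = pr v.
  move=> prE; apply: (@recurrence_periodic R (fun n => pr (iter n rot v)) k) => // n.
  exact: rot_rec.
rewrite [LHS]surjective_pairing [(iter _ _ _).1]surjective_pairing.
rewrite (per (fun v => v.1.1)) ?(per (fun v => v.1.2)) ?(per (fun v => v.2)).
- by case: v {per} => [[]].
- by constructor 3.
- by constructor 2.
- by constructor 1.
Qed.

Lemma involM (f : V -> V) (fK : involutive f) :
  (perm (inv_inj fK) * perm (inv_inj fK) = 1)%g.
Proof. by apply/permP=> v; rewrite permM !permE fK. Qed.

Lemma perm_conj (f g h : V -> V) (fK : involutive f) (gK : involutive g)
    (hK : involutive h) : f \o g =1 g \o h ->
  (perm (inv_inj hK) ^ perm (inv_inj gK) = perm (inv_inj fK))%g.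
Proof.
move=> fg; apply: (mulgI (perm (inv_inj gK))); rewrite -conjgC.
by apply/permP=> v; rewrite !permM !permE; apply/esym/fg.
Qed.

Lemma half_turn_regular_map k : (0 < k)%N -> (2 : R) != 0 ->
  (lucas k)%:~R = 0 :> R ->
  exists M : regular_map,
    [/\ valency M = k.*2.+1, self_dual M & self_petrie_dual M].
Proof.
move=> k_gt0 two_neq0 lk0.
have neqN1 : (- 1 : R) != 1.
  by apply: contraNneq two_neq0 => e1; rewrite -[2]/(1 + 1) -{1}e1 addNr.
pose x := perm (inv_inj half_turn1K); pose y := perm (inv_inj half_turn2K).
pose z := perm (inv_inj half_turn_diagK).
(* [x * y] is the half-turn about the third axis. Swapping axes 1 and 2 gives self-duality; swapping
   axes 1 and 3 gives self-Petrie-duality. *)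
apply: (@regular_map_of_odd_order _ x y z
  (perm (inv_inj swap12K)) (perm (inv_inj swap13K)) k.*2.+1);
  rewrite ?involM //.
- by rewrite /= odd_double.
- by lia.
- rewrite order_dvdn; apply/eqP/permP=> v.
  rewrite permX perm1 -[RHS](iter_rot v lk0); apply: eq_iter => {}v.
  by rewrite permM !permE.
- apply: contraNneq neqN1 => /permP/(_ (0, 1, 0)).
  by rewrite !permE => -[->].
- apply: contraNneq neqN1 => /permP/(_ (1, 0, 0)).
  by rewrite !permE => -[->].
(* A trivial [z] would fix (0, 1, 0), giving [2 * e = 0] and, after multiplication by 3, 2 = 0. *)
- apply: contraNneq two_neq0 => /permP/(_ (0, 1, 0)).
  rewrite !permE /= add0r addr0 mulr1 subr0 => -[e0 _ _].
  by have := third_double 1; rewrite mulr1 e0 mulr0 mulr1 => <-.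
- by apply: perm_conj => -[[a b] c].
- by apply: perm_conj => -[[a b] c].
- by apply: perm_conj => -[[a b] c] /=; rewrite [b + a]addrC.
(* The target [x * y] is a product rather than a single [perm (inv_inj _)], so [perm_conj] does not
   match. *)
- apply: (mulgI (perm (inv_inj swap13K))); rewrite -conjgC.
  by apply/permP=> -[[a b] c]; rewrite !permM !permE /= opprK.
- by apply: perm_conj => -[[a b] c].
- apply: perm_conj => -[[a b] c] /=.
  by rewrite (_ : c + b + a = a + b + c) //; ring.
Qed.

End HalfTurns.

(** * Choice of the modulus *)

(** Modulo the absolute value of [lucas k], the period relation holds, 3 is invertible by
    coprimality, and 2 is nonzero because the modulus exceeds 10. *)
Lemma exists_regular_map_odd k : (1 < k)%N ->
  exists M : regular_map,
    [/\ valency M = k.*2.+1, self_dual M & self_petrie_dual M].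
Proof.
move=> k_gt1; pose N := `|lucas k|%N.
have N_gt10 : (10 < N)%N := lucas_abs_gt k_gt1.
(* ['Z_N] is the ring of integers modulo [N] only when [N] exceeds 1. *)
have N_gt1 : (1 < N)%N by lia.
have NR n : (n%:R == 0 :> 'Z_N) = (N %| n)%N.
  by rewrite -(inj_eq val_inj) /= val_Zp_nat.
have [e e3] : exists e : 'Z_N, 3 * e = 1.
  have : (3 : 'Z_N) \is a GRing.unit by rewrite unitZpE // lucas_coprime3.
  by case/unitrPr=> e e3; exists e.
apply: (half_turn_regular_map e3); first by lia.
  by rewrite NR gtnNdvd //; lia.
have N0 : N%:R = 0 :> 'Z_N by apply/eqP; rewrite NR.
by rewrite (intEsign (lucas k)) rmorphM /= -/N -pmulrn N0 mulr0.
Qed.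

End Rotations.

Theorem theorem4p3 (d : nat) (d_odd : odd d) (d_ge5 : 5 <= d) :
  exists M : regular_map,
    [/\ valency M = d, self_dual M & self_petrie_dual M].
Proof.
(* The bound 5 on [d] gives [1 < d./2], as required for [lucas] to differ from 1. *)
have -> : d = d./2.*2.+1 by rewrite -{1}(odd_double_half d) d_odd.
by apply: exists_regular_map_odd; lia.
Qed.
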